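(* Let $f\colon\mathbb{R}^n\to\mathbb{R}$ be locally Lipschitz continuous, let $\Gamma\colon\mathbb{R}^n\rightrightarrows\mathbb{R}^\ell$ be a set-valued mapping with closed graph, and let $C\subset\mathbb{R}^n$ be nonempty and closed. Let $\bar x$ be a local minimizer of the problem $$\min f(x)\quad\text{subject to}\quad 0\in\Gamma(x),\ x\in C,$$ and assume that $\bar x$ is dAM-regular. Furthermore, let $\Gamma$ possess the Aubin property at $(\bar x,0)$. Then $\bar x$ is an M-stationary point of this problem, i.e., there exists $\tilde\lambda\in\mathbb{R}^\ell$ such that $$0\in\partial f(\bar x)+D^*\Gamma(\bar x,0)(\tilde\lambda)+\mathcal{N}_C(\bar x).$$
   Context: The problem is the instance $\Phi(x):=\Gamma(x)\times(x-C)$ of the general problem of minimizing $f(x)$ subject to $0\in\Phi(x)$; the M-stationarity condition $0\in\partial f(\bar x)+D^*\Phi(\bar x,0)(\lambda)$ for some $\lambda\in\mathbb{R}^{\ell}\times\mathbb{R}^n$ takes the form displayed in the claim. Normal cones: for a set $A\subset\mathbb{R}^d$ and $\bar a\in A$, the tangent (Bouligand) cone is $\mathcal{T}_A(\bar a):=\{d\mid \exists t_k\searrow 0,\ d_k\to d\colon \bar a+t_kd_k\in A\ \forall k\}$, the regular normal cone is its polar $\widehat{\mathcal{N}}_A(\bar a):=\{v\mid v^\top d\le 0\ \forall d\in\mathcal{T}_A(\bar a)\}$, and the limiting normal cone is $\mathcal{N}_A(\bar a):=\{v\mid\exists a_k\to\bar a,\ a_k\in A,\ v_k\to v,\ v_k\in\widehat{\mathcal{N}}_A(a_k)\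 \forall k\}$. All these sets are empty at points outside $A$. Limiting subdifferential: $\partial f(\bar x):=\{v\in\mathbb{R}^n\mid (v,-1)\in\mathcal{N}_{\operatorname{epi}f}(\bar x,f(\bar x))\}$, where $\operatorname{epi}f:=\{(x,\alpha)\mid\alpha\ge f(x)\}$. Limiting coderivative: with $\operatorname{gph}\Gamma:=\{(x,y)\mid y\in\Gamma(x)\}$, set $D^*\Gamma(x,y)(y^* ):=\{x^*\mid (x^*,-y^* )\in\mathcal{N}_{\operatorname{gph}\Gamma}(x,y)\}$ (empty if $(x,y)\notin\operatorname{gph}\Gamma$). Aubin property: $\Gamma$ has the Aubin property at $(\bar x,\bar y)\in\operatorname{gph}\Gamma$ if there are neighborhoods $U$ of $\bar x$, $V$ of $\bar y$ and $\kappa>0$ with $\Gamma(x)\cap V\subset\Gamma(x')+\kappa\|x-x'\|\mathbb{B}$ for all $x,x'\in U$, where $\mathbb{B}$ is the closed Euclidean unit ball. dAM-regularity: let $\widetilde{\mathcal{M}}(x,\tilde y):=\bigcup_{\tilde\lambda\in\mathbb{R}^\ell}D^*\Gamma(x,\tilde y)(\tilde\lambda)+\mathcal{N}_C(x)\subset\mathbb{R}^n$ for $(x,\tilde y)\in\mathbb{R}^n\times\mathbb{R}^\ell$ (a sum with an empty set is empty). A feasible point $\bar x$ (i.e., $0\in\Gamma(\bar x)$, $\bar x\in C$) is decoupled asymptotically Mordukhovich-regular (dAM-regular) if $\limsup_{x\to\bar x,\,\tilde y\to0}\widetilde{\mathcal{M}}(x,\tilde y)\subset\widetilde{\mathcal{M}}(\bar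 x,0)$, where the left-hand side is the set of all $x^*$ for which there are sequences $x_k\to\bar x$, $\tilde y_k\to0$, $x_k^*\to x^*$ with $x_k^*\in\widetilde{\mathcal{M}}(x_k,\tilde y_k)$ for all $k\in\mathbb{N}$. *)

(* Defs.v *)
From HB Require Import structures.
From mathcomp Require Import all_boot all_order all_algebra.
From mathcomp Require Import all_classical all_reals all_analysis.
Set Implicit Arguments.
Unset Strict Implicit.
Unset Printing Implicit Defensive.
Import Order.TTheory GRing.Theory Num.Theory.
Import numFieldNormedType.Exports.
Local Open Scope classical_set_scope.
Local Open Scope ring_scope.

(* The library norm on matrices is the max norm; it induces the topology used
   below, but the Lipschitz and Aubin estimates are stated in the Euclidean
   norm. *)
Definition dotv (R : realType) (d : nat) (u v : 'rV[R]_d) : R :=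
  \sum_i u 0 i * v 0 i.

Definition enorm (R : realType) (d : nat) (u : 'rV[R]_d) : R :=
  Num.sqrt (dotv u u).

Definition eunit_ball (R : realType) (d : nat) : set 'rV[R]_d :=
  [set u | enorm u <= 1].

Definition minkowski_sum (R : realType) (d : nat) (A B : set 'rV[R]_d) :
    set 'rV[R]_d :=
  [set u + v | u in A & v in B].

(* The three cones are empty at base points outside [A]. *)
Definition tangent_cone (R : realType) (d : nat) (A : set 'rV[R]_d)
    (a : 'rV[R]_d) : set 'rV[R]_d :=
  [set w | A a /\
    exists (t : nat -> R) (w_ : nat -> 'rV[R]_d),
      [/\ forall k, 0 < t k,
          t k @[k --> \oo] --> (0 : R),
          w_ k @[k --> \oo] --> w
        & forall k, A (a + t k *: w_ k)]].

Definition regular_normal_cone (R : realType) (d : nat) (A : set 'rV[R]_d)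
    (a : 'rV[R]_d) : set 'rV[R]_d :=
  [set v | A a /\ forall w, tangent_cone A a w -> dotv v w <= 0].

Definition limiting_normal_cone (R : realType) (d : nat) (A : set 'rV[R]_d)
    (a : 'rV[R]_d) : set 'rV[R]_d :=
  [set v | A a /\
    exists (a_ v_ : nat -> 'rV[R]_d),
      [/\ a_ k @[k --> \oo] --> a,
          forall k, A (a_ k),
          v_ k @[k --> \oo] --> v
        & forall k, regular_normal_cone A (a_ k) (v_ k)]].

(* Pairs [(x, y)] are encoded as [row_mx x y]; a real [r] as [r%:M : 'rV_1]. *)
Definition epigraph (R : realType) (n : nat) (f : 'rV[R]_n -> R) :
    set 'rV[R]_(n + 1) :=
  [set z | f (lsubmx z) <= rsubmx z 0 0].

Definition graph_of (R : realType) (n l : nat)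
    (Gamma : 'rV[R]_n -> set 'rV[R]_l) : set 'rV[R]_(n + l) :=
  [set z | Gamma (lsubmx z) (rsubmx z)].

Definition limiting_subdifferential (R : realType) (n : nat)
    (f : 'rV[R]_n -> R) (x : 'rV[R]_n) : set 'rV[R]_n :=
  [set v | limiting_normal_cone (epigraph f)
             (row_mx x (f x)%:M) (row_mx v (- 1)%:M)].

Definition limiting_coderivative (R : realType) (n l : nat)
    (Gamma : 'rV[R]_n -> set 'rV[R]_l) (x : 'rV[R]_n) (y ys : 'rV[R]_l) :
    set 'rV[R]_n :=
  [set xs | limiting_normal_cone (graph_of Gamma)
              (row_mx x y) (row_mx xs (- ys))].

Definition locally_lipschitz (R : realType) (n : nat) (f : 'rV[R]_n -> R) :=
  forall x : 'rV[R]_n, exists2 U : set 'rV[R]_n, nbhs x U &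
    exists L : R, forall y z, U y -> U z -> `|f y - f z| <= L * enorm (y - z).

Definition aubin_property (R : realType) (n l : nat)
    (Gamma : 'rV[R]_n -> set 'rV[R]_l) (x0 : 'rV[R]_n) (y0 : 'rV[R]_l) :=
  graph_of Gamma (row_mx x0 y0) /\
  exists (U : set 'rV[R]_n) (V : set 'rV[R]_l) (kappa : R),
    [/\ nbhs x0 U, nbhs y0 V, 0 < kappa &
      forall x x', U x -> U x' ->
        Gamma x `&` V `<=`
          minkowski_sum (Gamma x')
            [set (kappa * enorm (x - x')) *: b | b in @eunit_ball R l]].

Definition feasible (R : realType) (n l : nat)
    (Gamma : 'rV[R]_n -> set 'rV[R]_l) (C : set 'rV[R]_n) : set 'rV[R]_n :=
  [set x | Gamma x 0 /\ C x].

Definition local_minimizer (R : realType) (n : nat) (f : 'rV[R]_n -> R)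
    (F : set 'rV[R]_n) (x0 : 'rV[R]_n) :=
  F x0 /\ \forall x \near x0, F x -> f x0 <= f x.

Definition Mtilde (R : realType) (n l : nat)
    (Gamma : 'rV[R]_n -> set 'rV[R]_l) (C : set 'rV[R]_n)
    (x : 'rV[R]_n) (y : 'rV[R]_l) : set 'rV[R]_n :=
  minkowski_sum (\bigcup_lambda limiting_coderivative Gamma x y lambda)
                (limiting_normal_cone C x).

Definition outer_limit (R : realType) (n l m : nat)
    (S : 'rV[R]_n -> 'rV[R]_l -> set 'rV[R]_m)
    (x0 : 'rV[R]_n) (y0 : 'rV[R]_l) : set 'rV[R]_m :=
  [set xs | exists (x_ : nat -> 'rV[R]_n) (y_ : nat -> 'rV[R]_l)
                   (xs_ : nat -> 'rV[R]_m),
     [/\ x_ k @[k --> \oo] --> x0,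
         y_ k @[k --> \oo] --> y0,
         xs_ k @[k --> \oo] --> xs
       & forall k, S (x_ k) (y_ k) (xs_ k)]].

Definition dAM_regular (R : realType) (n l : nat)
    (Gamma : 'rV[R]_n -> set 'rV[R]_l) (C : set 'rV[R]_n) (x0 : 'rV[R]_n) :=
  feasible Gamma C x0 /\
  outer_limit (Mtilde Gamma C) x0 0 `<=` Mtilde Gamma C x0 0.

Definition M_stationary (R : realType) (n l : nat) (f : 'rV[R]_n -> R)
    (Gamma : 'rV[R]_n -> set 'rV[R]_l) (C : set 'rV[R]_n) (x0 : 'rV[R]_n) :=
  exists lambda : 'rV[R]_l,
    minkowski_sum
      (minkowski_sum (limiting_subdifferential f x0)
                     (limiting_coderivative Gamma x0 0 lambda))
      (limiting_normal_cone C x0) 0.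

(* Main.v *)
Require Import Defs.
From mathcomp Require Import all_boot all_order all_algebra.
From mathcomp Require Import all_classical all_reals all_analysis.
From mathcomp Require Import ring lra.
Import Order.TTheory GRing.Theory Num.Theory.
Import numFieldNormedType.Exports.
Local Open Scope classical_set_scope.
Local Open Scope ring_scope.
Set Implicit Arguments.
Unset Strict Implicit.
Unset Printing Implicit Defensive.

(* For each k, minimize f(x) + |x - x0|^2 + k |y|^2 over gph Gamma and x in C
   near (x0, 0); the minimizers (x_k, y_k) tend to (x0, 0). At fixed k, give f,
   gph Gamma and C separate copies z, (x, y), x' of the variable, recoupled by the
   penalty j (|z - x|^2 + |z - x'|^2). Each block of a minimizer yields a regular
   normal. As j tends to infinity the normal to epi f stays bounded because f is
   Lipschitz, the one to gph Gamma because of the Aubin property (its y-part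
   converges), hence also the one to C; the limits are limiting normals at the
   common point (x_k, y_k). This gives s_k in the subdifferential of f at x_k
   with -s_k - 2 (x_k - x0) in Mtilde(x_k, y_k). The s_k are bounded by the
   Lipschitz constant, so dAM-regularity applies to a cluster point. *)

(** * Euclidean inner product and norm on row vectors *)

Section EuclideanVectors.
Variables (R : realType) (d : nat).
Implicit Types (u v w : 'rV[R]_d) (a : R).

Lemma dotvC u v : dotv u v = dotv v u.
Proof. by apply: eq_bigr => i _; rewrite mulrC. Qed.

Lemma dotvDl u v w : dotv (u + v) w = dotv u w + dotv v w.
Proof. by rewrite -big_split; apply: eq_bigr => i _; rewrite !mxE mulrDl. Qed.

Lemma dotvZl a u v : dotv (a *: u) v = a * dotv u v.
Proof. by rewrite /dotv mulr_sumr; apply: eq_bigr => i _; rewrite mxE mulrA. Qed.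

Lemma dotvNl u v : dotv (- u) v = - dotv u v.
Proof. by rewrite -scaleN1r dotvZl mulN1r. Qed.

Lemma dotvDr u v w : dotv u (v + w) = dotv u v + dotv u w.
Proof. by rewrite dotvC dotvDl !(dotvC u). Qed.

Lemma dotvZr a u v : dotv u (a *: v) = a * dotv u v.
Proof. by rewrite dotvC dotvZl dotvC. Qed.

Lemma dotvNr u v : dotv u (- v) = - dotv u v.
Proof. by rewrite dotvC dotvNl dotvC. Qed.

Lemma dotv0r u : dotv u 0 = 0.
Proof. by rewrite -(scale0r 0) dotvZr mul0r. Qed.

Lemma dotv0l u : dotv 0 u = 0.
Proof. by rewrite dotvC dotv0r. Qed.

Lemma dotv_ge0 u : 0 <= dotv u u.
Proof. by apply: sumr_ge0 => i _; rewrite -expr2 sqr_ge0. Qed.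

Lemma dotv_eq0 u : (dotv u u == 0) = (u == 0).
Proof.
apply/idP/eqP => [|->]; last by rewrite dotv0r.
rewrite psumr_eq0 => [/allP h|i _]; last by rewrite -expr2 sqr_ge0.
apply/rowP => i; apply/eqP; rewrite mxE.
by have /implyP := h i (mem_index_enum i); rewrite -expr2 sqrf_eq0; apply.
Qed.

Lemma enorm_ge0 u : 0 <= enorm u.
Proof. exact: sqrtr_ge0. Qed.

Lemma enorm_sqr u : enorm u ^+ 2 = dotv u u.
Proof. by rewrite sqr_sqrtr// dotv_ge0. Qed.

Lemma enormZ a u : enorm (a *: u) = `|a| * enorm u.
Proof.
by rewrite /enorm dotvZl dotvZr mulrA -expr2 sqrtrM ?sqr_ge0// sqrtr_sqr.
Qed.

Lemma enormN u : enorm (- u) = enorm u.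
Proof. by rewrite -scaleN1r enormZ normrN1 mul1r. Qed.

(** The squared norm of [dotv v v *: u - dotv u v *: v] equals [dotv v v] times the gap
    [dotv u u * dotv v v - dotv u v ^+ 2]. *)
Lemma cauchy_schwarz u v : `|dotv u v| <= enorm u * enorm v.
Proof.
rewrite -ler_sqr ?nnegrE ?mulr_ge0 ?enorm_ge0// real_normK ?num_real//.
rewrite exprMn !enorm_sqr.
have [->|v0] := eqVneq v 0; first by rewrite !dotv0r expr0n mulr0.
have vp : 0 < dotv v v by rewrite lt_def dotv_eq0 v0 dotv_ge0.
suff: 0 <= dotv v v * (dotv u u * dotv v v - dotv u v ^+ 2).
  by rewrite pmulr_rge0// subr_ge0.
have := dotv_ge0 (dotv v v *: u - dotv u v *: v).
rewrite !(dotvDl, dotvDr, dotvNl, dotvNr, dotvZl, dotvZr) (dotvC v u).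
by move=> h; apply: le_trans h _; rewrite le_eqVlt; apply/orP; left; apply/eqP; ring.
Qed.

(** Transfers Euclidean bounds to the max norm, in which compact balls are taken. *)
Lemma normr_le_enorm u : `|u| <= enorm u.
Proof.
rewrite [leLHS]/Num.norm/= mx_normrE; apply: bigmax_le; first exact: enorm_ge0.
move=> [i j] _ /=; rewrite ord1 -ler_sqr ?nnegrE ?enorm_ge0//.
rewrite real_normK ?num_real// enorm_sqr /dotv (bigD1 j)//= -expr2 lerDl.
by apply: sumr_ge0 => k _; rewrite -expr2 sqr_ge0.
Qed.

Lemma cvg_dotv (T : Type) (F : set_system T) {FF : Filter F}
    (p q : T -> 'rV[R]_d) u v :
  p x @[x --> F] --> u -> q x @[x --> F] --> v ->
  dotv (p x) (q x) @[x --> F] --> dotv u v.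
Proof.
move=> pu qv; apply: cvg_big => [|i _]; first exact: add_continuous.
apply: cvgM.
  exact: (cvg_comp _ _ pu (@coord_continuous R _ _ 0 i u)).
exact: (cvg_comp _ _ qv (@coord_continuous R _ _ 0 i v)).
Qed.

Lemma cvg_enorm (T : Type) (F : set_system T) {FF : Filter F}
    (p : T -> 'rV[R]_d) u :
  p x @[x --> F] --> u -> enorm (p x) @[x --> F] --> enorm u.
Proof.
move=> pu; apply: (@continuous_cvg _ _ _ _ _ (fun x => dotv (p x) (p x)) Num.sqrt).
  exact: sqrt_continuous.
exact: cvg_dotv.
Qed.

Lemma compact_norm_ball u a : compact [set v : 'rV[R]_d | `|u - v| <= a].
Proof.
apply: bounded_closed_compact.
  exists (a + `|u|); split; rewrite ?num_real// => x ax v /=; rewrite distrC => va.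
  rewrite (le_trans _ (ltW ax))// -[v](subrK u).
  by rewrite (le_trans (ler_normD _ _))// lerD2r.
exact: closed_closed_ball_.
Qed.

Lemma compact_eunit_ball : compact (@eunit_ball R d).
Proof.
apply: subclosed_compact (@compact_norm_ball 0 1) _; last first.
  by move=> v /= v1; rewrite sub0r normrN (le_trans (normr_le_enorm v)).
apply: (@preimage_closed _ _ (@enorm R d) [set x | x <= 1]).
  by move=> v _; exact: (@cvg_enorm _ (nbhs v) _ id).
exact: closed_le.
Qed.

End EuclideanVectors.

(** * Block vectors, convergent subsequences and penalization *)

Lemma dotv_row_mx (R : realType) (n l : nat) (u v : 'rV[R]_n) (y z : 'rV[R]_l) :
  dotv (row_mx u y) (row_mx v z) = dotv u v + dotv y z.
Proof.
rewrite /dotv big_split_ord; congr +%R; apply: eq_bigr => i _;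
  by rewrite ?row_mxEl ?row_mxEr.
Qed.

Lemma cvg_row_mx (R : realType) (n l : nat) (T : Type) (F : set_system T)
    {FF : Filter F} (p : T -> 'rV[R]_n) (q : T -> 'rV[R]_l) (u : 'rV[R]_n) (v : 'rV[R]_l) :
  p x @[x --> F] --> u -> q x @[x --> F] --> v ->
  row_mx (p x) (q x) @[x --> F] --> row_mx u v.
Proof.
move=> /cvgrPdist_le pu /cvgrPdist_le qv; apply/cvgrPdist_le => e e0.
have := pu _ e0; have := qv _ e0; apply: filterS2 => x qe pe.
rewrite opp_row_mx add_row_mx [leLHS]/Num.norm/= mx_normrE.
apply: bigmax_le => [|[i j] _ /=]; first exact: ltW.
rewrite mxE; case: splitP => k _.
  apply: le_trans pe; rewrite [leRHS]/Num.norm/= mx_normrE.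
  exact: (le_bigmax _ (fun ij => `|(u - p x) ij.1 ij.2|) (i, k)).
apply: le_trans qe; rewrite [leRHS]/Num.norm/= mx_normrE.
exact: (le_bigmax _ (fun ij => `|(v - q x) ij.1 ij.2|) (i, k)).
Qed.

(** The index [phi k >= k] is one at which [u] lies within [1/(k+1)] of a cluster point. The map
    [phi] need not be increasing; its divergence is enough to transfer limits and eventual
    properties. *)
Lemma compact_subsequence (R : realType) (T : pseudoMetricType R) (K : set T)
    (u : nat -> T) :
  compact K -> (\forall k \near \oo, K (u k)) ->
  exists p (phi : nat -> nat), [/\ K p, phi k @[k --> \oo] --> \oo &
    u (phi k) @[k --> \oo] --> p].
Proof.
move=> cK Ku; have [p [Kp clp]] := cK (u @ \oo) _ Ku.
have step k : exists j, (k <= j)%N /\ ball p (k.+1%:R^-1) (u j).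
  have kj : (u @ \oo) (u @` [set j | (k <= j)%N]).
    by exists k => // j /= kj; exists j.
  have pB : nbhs p (ball p (k.+1%:R^-1 : R)) by apply: nbhsx_ballx.
  by have [_ [[j /= kj' <-] pj]] := clp _ _ kj pB; exists j.
have [phi hphi] := choice step.
exists p, phi; split => //.
  apply/cvgnyPge => A; exists A => // k /= Ak.
  by rewrite (leq_trans Ak)//; have [] := hphi k.
apply/cvg_ballP => e e0.
have := near_infty_natSinv_lt (PosNum e0); apply: filterS => k ke.
by apply: le_ball (ltW ke) _ _; have [] := hphi k.
Qed.

(** Comparison with [q0] bounds each minimal penalized value by [F q0]. Every other point of [K] has
    a neighborhood on which the penalized value exceeds [F q0] for all large [k], so compactness
    forces the minimizers into any given neighborhood of [q0]. *)
Lemma penalty_minimizers (R : realType) (T : topologicalType) (K : set T)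
    (F P : T -> R) (q0 : T) :
  compact K -> continuous F -> continuous P -> (forall q, 0 <= P q) ->
  K q0 -> P q0 = 0 ->
  (forall q, K q -> P q = 0 -> q <> q0 -> F q0 < F q) ->
  exists q_ : nat -> T,
    (forall k, K (q_ k) /\
       forall q, K q -> F (q_ k) + k%:R * P (q_ k) <= F q + k%:R * P q) /\
    q_ k @[k --> \oo] --> q0.
Proof.
move=> cK cF cP P0 Kq0 Pq0 uniq.
have cFP (k : nat) : continuous (fun q => F q + k%:R * P q).
  by move=> q; apply: cvgD; [exact: cF|apply: cvgM; [exact: cvg_cst|exact: cP]].
have step (k : nat) : exists p, K p /\
    forall q, K q -> F p + k%:R * P p <= F q + k%:R * P q.
  have K0 : K !=set0 by exists q0.
  have [p pK h] := compact_EVT_min K0 cK (continuous_subspaceT (cFP k)).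
  by exists p; split=> [|q Kq]; [exact/set_mem|apply: h; exact/mem_set].
have [q_ hq] := choice step; exists q_; split => // U /= Uq0.
suff : \forall k \near \oo, K `<=` [set q | ~ U q -> F q0 < F q + k%:R * P q].
  apply: filterS => k KU; have [Kk hk] := hq k.
  apply: contrapT => /(KU _ Kk); apply/negP.
  by rewrite -leNgt (le_trans (hk _ Kq0))// Pq0 mulr0 addr0.
(* The covering form of compactness makes the threshold on [k], found near each [q], uniform over
   [K]. *)
have /compact_near_coveringP := cK; apply => q Kq.
have [->|qq0] := pselect (q = q0).
  exists (U, setT) => //=; first by split=> //; exact: filterT.
  by move=> [q' k] [].
(* Where [P q = 0], strictness of [q0] allows [k0 = 0]; elsewhere any weight above
   [(F q0 - F q) / P q] works. *)
have [k0 hk0] : exists k0 : nat, F q0 < F q + k0%:R * P q.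
  have [Pq|Pq] := eqVneq (P q) 0; first by exists 0; rewrite mul0r addr0 uniq.
  have Pq' : 0 < P q by rewrite lt_def Pq P0.
  have [k0 _ /(_ _ (leqnn k0)) hk0] := nbhs_infty_gtr ((F q0 - F q) / P q).
  by exists k0; rewrite -ltrBlDl -ltr_pdivrMr.
exists ([set q' | F q0 < F q' + k0%:R * P q'], [set k | (k0 <= k)%N]) => /=.
  split; last by exists k0.
  exact: (cvgr_gt _ (cFP k0 q) _ hk0).
move=> [q' k] /= [h1 h2] _; apply: lt_le_trans h1 _.
by rewrite lerD2l ler_wpM2r// ler_nat.
Qed.

(** * Normal cones: a variational criterion, closedness, tangent sequences *)

Section NormalCones.
Variables (R : realType) (d : nat).
Implicit Types (A : set 'rV[R]_d) (a v w : 'rV[R]_d).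

(** Along a tangent sequence the quadratic error, divided by [t k], is of order [t k] and vanishes.
    Exact second-order expansions of the penalties can therefore be fed in directly. *)
Lemma regular_normal_cone_min A a v c : A a ->
  (\forall p \near a, A p -> 0 <= dotv v (p - a) + c * dotv (p - a) (p - a)) ->
  regular_normal_cone A a (- v).
Proof.
move=> Aa hmin; split => // w [_ [t [w_ [t0 tcvg wcvg Aw]]]].
rewrite dotvNl oppr_le0.
have acvg : a + t k *: w_ k @[k --> \oo] --> a.
  have -> : nbhs a = nbhs (a + 0 *: w) by rewrite scale0r addr0.
  by apply: cvgD; [exact: cvg_cst|exact: cvgZ].
have lim : dotv v (w_ k) + c * t k * dotv (w_ k) (w_ k) @[k --> \oo] -->
    dotv v w + c * 0 * dotv w w.
  apply: cvgD; first by apply: cvg_dotv => //; exact: cvg_cst.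
  apply: cvgM; last exact: cvg_dotv.
  by apply: cvgM => //; exact: cvg_cst.
rewrite mulr0 mul0r addr0 in lim.
apply: (ler_cvg_to (cvg_cst 0) lim).
have := acvg _ hmin; rewrite /= /nbhs /=; apply: filterS => k /= /(_ (Aw k)).
rewrite [a + _]addrC addrK !dotvZr dotvZl.
have -> : t k * dotv v (w_ k) + c * (t k * (t k * dotv (w_ k) (w_ k))) =
  t k * (dotv v (w_ k) + c * t k * dotv (w_ k) (w_ k)) by ring.
by rewrite pmulr_rge0.
Qed.

(** Diagonal argument: half of the tolerance [1/(m+1)] is spent on reaching [(a_ k, v_ k)], the
    other half on approximating that pair by a regular normal. *)
Lemma limiting_normal_cone_closed A a v (a_ v_ : nat -> 'rV[R]_d) : A a ->
  a_ k @[k --> \oo] --> a -> v_ k @[k --> \oo] --> v ->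
  (\forall k \near \oo, limiting_normal_cone A (a_ k) (v_ k)) ->
  limiting_normal_cone A a v.
Proof.
move=> Aa acvg vcvg Nk; split => //.
have step (m : nat) : exists q : 'rV[R]_d * 'rV[R]_d, [/\ A q.1,
    `|a - q.1| < m.+1%:R^-1, `|v - q.2| < m.+1%:R^-1 &
    regular_normal_cone A q.1 q.2].
  have e0 : 0 < m.+1%:R^-1 / 2 :> R by rewrite divr_gt0// invr_gt0.
  near \oo => k.
  have ak : `|a - a_ k| < m.+1%:R^-1 / 2 by near: k; exact: cvgr_dist_lt.
  have vk : `|v - v_ k| < m.+1%:R^-1 / 2 by near: k; exact: cvgr_dist_lt.
  have [Ak [b [u [bcvg Ab ucvg Nb]]]] :
    limiting_normal_cone A (a_ k) (v_ k) by near: k.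
  near \oo => j; exists (b j, u j); split => //=.
    rewrite (splitr (m.+1%:R^-1)) (le_lt_trans (ler_distD (a_ k) _ _))//.
    by rewrite ltrD//; near: j; exact: cvgr_dist_lt.
  rewrite (splitr (m.+1%:R^-1)) (le_lt_trans (ler_distD (v_ k) _ _))//.
  by rewrite ltrD//; near: j; exact: cvgr_dist_lt.
have [q hq] := choice step.
exists (fst \o q), (snd \o q); split => [|k||k].
- apply/cvgrPdist_lt => e e0.
  apply: filterS (near_infty_natSinv_lt (PosNum e0)) => k ke.
  by have [_ h _ _] := hq k; exact: lt_trans ke.
- by have [] := hq k.
- apply/cvgrPdist_lt => e e0.
  apply: filterS (near_infty_natSinv_lt (PosNum e0)) => k ke.
  by have [_ _ h _] := hq k; exact: lt_trans ke.
- by have [] := hq k.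
Unshelve. all: by end_near. Qed.

Lemma regular_limiting_normal_cone A a :
  regular_normal_cone A a `<=` limiting_normal_cone A a.
Proof.
move=> v [Aa h]; split => //; exists (fun=> a), (fun=> v).
by split => //; exact: cvg_cst.
Qed.

(** With steps [e / (k+1)] this supplies the sequences that certify tangent directions. *)
Lemma near_ray a w (U : set 'rV[R]_d) : nbhs a U ->
  exists2 e : R, 0 < e & forall t, 0 <= t <= e -> U (a + t *: w).
Proof.
move=> /nbhs_ballP[e /= e0 eU].
have w1 : 0 < `|w| + 1 by rewrite ltr_wpDl.
exists (e / 2 / (`|w| + 1)); first by rewrite !divr_gt0.
move=> t /andP[t0]; rewrite ler_pdivlMr// => te; apply: eU.
rewrite -ball_normE /= opprD addNKr normrN normrZ ger0_norm//.
apply: (@le_lt_trans _ _ (t * (`|w| + 1))); first by rewrite ler_wpM2l// lerDl.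
by rewrite (le_lt_trans te)// ltr_pdivrMr// mulr2n mulrDr mulr1 ltrDl.
Qed.

Lemma cvg_scaled_harmonic (e : R) : e / k.+1%:R @[k --> \oo] --> (0 : R).
Proof.
rewrite -[X in _ --> X](mulr0 e).
by apply: cvgM; [exact: cvg_cst|exact: cvg_harmonic].
Qed.

Lemma scaled_harmonic_itv (e : R) k : 0 < e -> 0 < e / k.+1%:R <= e.
Proof.
by move=> e0; rewrite divr_gt0//= ler_pdivrMr// -[leLHS]mulr1 ler_pM2l// ler1n.
Qed.

End NormalCones.

(** * Norm bounds for regular normals *)

(** The direction [(s, L |s|)] is tangent to the epigraph, because [f] rises along [s] at rate at
    most [L |s|]. Pairing it with the normal [(s, -1)] gives [|s|^2 <= L |s|]. *)
Lemma regular_normal_epigraph_bound (R : realType) (n : nat)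
    (f : 'rV[R]_n -> R) (x s : 'rV[R]_n) (U : set 'rV[R]_n) (L : R) :
  nbhs x U -> 0 <= L ->
  (forall y z, U y -> U z -> `|f y - f z| <= L * enorm (y - z)) ->
  regular_normal_cone (epigraph f) (row_mx x (f x)%:M) (row_mx s (- 1)%:M) ->
  enorm s <= L.
Proof.
move=> Ux L0 Lip [Ax /(_ (row_mx s (L * enorm s)%:M)) N].
have : enorm s ^+ 2 <= L * enorm s.
  rewrite enorm_sqr -subr_le0.
  move: N; rewrite dotv_row_mx {2}/dotv big_ord1 !mxE !mulr1n mulN1r; apply.
  split => //; have [e e0 eU] := near_ray s Ux.
  exists (fun k => e / k.+1%:R), (fun=> row_mx s (L * enorm s)%:M); split.
  - by move=> k; have /andP[] := scaled_harmonic_itv k e0.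
  - exact: cvg_scaled_harmonic.
  - exact: cvg_cst.
  move=> k; have /andP[t0 te] := scaled_harmonic_itv k e0.
  set t := e / _ in t0 te *.
  rewrite /epigraph /= scale_row_mx add_row_mx row_mxKl row_mxKr !mxE !mulr1n.
  rewrite -lerBlDl (le_trans (ler_norm _))//.
  have Ut : U (x + t *: s) by apply: eU; rewrite (ltW t0).
  rewrite (le_trans (Lip _ _ Ut (nbhs_singleton Ux)))//.
  by rewrite [x + _]addrC addrK enormZ gtr0_norm// mulrCA.
have [->|s0] := eqVneq (enorm s) 0; first by [].
by rewrite expr2 ler_pM2r// lt_def s0 enorm_ge0.
Qed.

(* The tangent direction along [lsubmx g] supplied by the Aubin property has a
   second component of size at most [kappa * enorm (lsubmx g)]. *)
Lemma aubin_regular_normal_bound (R : realType) (n l : nat)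
    (Gamma : 'rV[R]_n -> set 'rV[R]_l) (U : set 'rV[R]_n) (V : set 'rV[R]_l)
    (kappa : R) (w g : 'rV[R]_(n + l)) :
  nbhs (lsubmx w) U -> V (rsubmx w) -> 0 <= kappa ->
  (forall x x', U x -> U x' -> Gamma x `&` V `<=` minkowski_sum (Gamma x')
     [set (kappa * enorm (x - x')) *: b | b in @eunit_ball R l]) ->
  regular_normal_cone (graph_of Gamma) w g ->
  enorm (lsubmx g) <= kappa * enorm (rsubmx g).
Proof.
move=> Uw Vw k0 aubin [Gw N]; set u := lsubmx g; set x := lsubmx w.
have [e e0 eU] := near_ray u Uw; pose t k := e / k.+1%:R : R.
(* Passing from [x] to [x + t k *: u], the Aubin inclusion writes [rsubmx w] as a value [y] at the
   new point plus [kappa * t k * |u|] times [b]; solving for [y] produces the minus sign. *)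
have step k : exists b, eunit_ball b /\
    graph_of Gamma (w + t k *: row_mx u (- (kappa * enorm u) *: b)).
  have /andP[t0 te] := scaled_harmonic_itv k e0.
  have Ux' : U (x + t k *: u) by apply: eU; rewrite ltW.
  have [y Gy [_ [b b1 <-] yb]] := aubin _ _ (nbhs_singleton Uw) Ux' _ (conj Gw Vw).
  exists b; split => //.
  rewrite -[w]hsubmxK scale_row_mx add_row_mx /graph_of /= row_mxKl row_mxKr.
  suff -> : rsubmx w + t k *: (- (kappa * enorm u) *: b) = y by [].
  have xt : enorm (x - (x + t k *: u)) = t k * enorm u.
    by rewrite opprD addNKr enormN enormZ gtr0_norm.
  rewrite -yb xt scalerA -addrA -scalerDl.
  have -> : kappa * (t k * enorm u) + t k * - (kappa * enorm u) = 0 by ring.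
  by rewrite scale0r addr0.
(* The vectors [b_ k] need not converge. A subsequential limit suffices, since the step sizes still
   tend to zero along [phi]. *)
have [b_ hb] := choice step.
have [|b [phi [Kb phicvg bcvg]]] :=
    @compact_subsequence R 'rV[R]_l _ b_ (@compact_eunit_ball R l).
  by apply: nearW => k; have [] := hb k.
have {}N : dotv g (row_mx u (- (kappa * enorm u) *: b)) <= 0.
  apply: N; split => //.
  exists (t \o phi), (fun k => row_mx u (- (kappa * enorm u) *: b_ (phi k))).
  split => [k|||k].
  - by have /andP[] := scaled_harmonic_itv (phi k) e0.
  - exact: (cvg_comp _ _ phicvg (cvg_scaled_harmonic e)).
  - apply: cvg_row_mx; first exact: cvg_cst.
    by apply: cvgZ => //; exact: cvg_cst.
  - by have [_ h] := hb (phi k); exact: h.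
have [u0|u0] := eqVneq (enorm u) 0; first by rewrite u0 mulr_ge0// enorm_ge0.
rewrite -(@ler_pM2r _ (enorm u)) ?lt_def ?u0 ?enorm_ge0// -expr2 enorm_sqr.
move: N; rewrite -[X in dotv X]hsubmxK dotv_row_mx -/u dotvZr.
rewrite mulNr subr_le0 => /le_trans; apply.
rewrite [leRHS]mulrAC ler_wpM2l ?mulr_ge0 ?enorm_ge0//.
rewrite (le_trans (ler_norm _))// (le_trans (cauchy_schwarz _ _))//.
by rewrite ler_piMr ?enorm_ge0.
Qed.

(** * Closedness of the subdifferential, and quadratic expansions *)

(** Continuity of [f] makes the epigraph points [(x_k, f(x_k))] converge, so closedness of limiting
    normals applies. *)
Lemma limiting_subdifferential_closed (R : realType) (n : nat)
    (f : 'rV[R]_n -> R) (x s : 'rV[R]_n) (x_ s_ : nat -> 'rV[R]_n) :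
  continuous f -> x_ k @[k --> \oo] --> x -> s_ k @[k --> \oo] --> s ->
  (\forall k \near \oo, limiting_subdifferential f (x_ k) (s_ k)) ->
  limiting_subdifferential f x s.
Proof.
move=> cf xcvg scvg; apply: limiting_normal_cone_closed.
- by rewrite /epigraph /= row_mxKl row_mxKr mxE mulr1n.
- have fcvg : (f (x_ k))%:M @[k --> \oo] --> ((f x)%:M : 'rV[R]_1).
    rewrite -scalemx1; under eq_fun do rewrite -scalemx1.
    by apply: cvgZ; [exact: (cvg_comp _ _ xcvg (cf _))|exact: cvg_cst].
  exact: (cvg_row_mx xcvg fcvg).
- exact: (cvg_row_mx scvg (cvg_cst _)).
Qed.

Lemma locally_lipschitz_continuous (R : realType) (n : nat)
    (f : 'rV[R]_n -> R) : locally_lipschitz f -> continuous f.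
Proof.
move=> hf x; have [U Ux [L hL]] := hf x.
apply/(@cvgrPdist_lt _ _ _ (nbhs x)) => e e0.
have Lcvg : L * enorm (x - y) @[y --> x] --> (0 : R).
  have -> : nbhs (0 : R) = nbhs (L * enorm (x - x)).
    by rewrite subrr /enorm dotv0r sqrtr0 mulr0.
  exact: (@cvgM _ _ (nbhs x) _ _ _ _ _ (cvg_cst L)
    (cvg_enorm (cvgB (cvg_cst x) (@cvg_id _ (nbhs x))))).
near=> y; apply: le_lt_trans (hL _ _ (nbhs_singleton Ux) _) _.
  by near: y.
by near: y; exact: (cvgr_lt _ Lcvg).
Unshelve. all: by end_near. Qed.

Lemma nbhs_norm_le (R : realType) (V : normedModType R) (x : V) (N : set V) :
  nbhs x N -> exists2 r : R, 0 < r & forall y, `|x - y| <= r -> N y.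
Proof.
move=> /nbhs_ballP[e /= e0 eN]; exists (e / 2); first by rewrite divr_gt0.
move=> y xy; apply: eN; rewrite -ball_normE /=.
by rewrite (le_lt_trans xy)// ltr_pdivrMr// mulr2n mulrDr mulr1 ltrDl.
Qed.

Lemma dotv_dist_expand (R : realType) (d : nat) (x y z : 'rV[R]_d) :
  dotv (y - z) (y - z) =
  dotv (x - z) (x - z) + 2 * dotv (x - z) (y - x) + dotv (y - x) (y - x).
Proof.
have -> : y - z = (x - z) + (y - x) by rewrite [RHS]addrC addrA subrK.
move: (x - z) (y - x) => u v.
by rewrite !(dotvDl, dotvDr) (dotvC v u); ring.
Qed.

Lemma dotv_distC (R : realType) (d : nat) (x y : 'rV[R]_d) :
  dotv (x - y) (x - y) = dotv (y - x) (y - x).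
Proof. by rewrite -opprB dotvNl dotvNr opprK. Qed.

Lemma dotv_hsubmx (R : realType) (n l : nat) (u v : 'rV[R]_(n + l)) :
  dotv u v = dotv (lsubmx u) (lsubmx v) + dotv (rsubmx u) (rsubmx v).
Proof. by rewrite -dotv_row_mx !hsubmxK. Qed.

(** Strictly inside the ball the localizing constraint is inactive, so it leaves no trace in the
    normal cones. *)
Lemma near_norm_ball (R : realType) (V : normedModType R) (a x : V) (r : R) :
  `|a - x| < r -> \forall y \near x, `|a - y| <= r.
Proof.
move=> ar; near=> y; rewrite -(subrKC `|a - x| r).
rewrite (le_trans (ler_distD x _ _))// lerD2l ltW//.
by near: y; apply: cvgr_dist_lt; [exact: cvg_id|rewrite subr_gt0].
Unshelve. all: by end_near. Qed.

(** * Multiplier rule at a strict local minimizer, by decoupling *)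

Section MultiplierRule.
Variables (R : realType) (n l : nat) (f : 'rV[R]_n -> R).
Variables (Gamma : 'rV[R]_n -> set 'rV[R]_l) (C : set 'rV[R]_n).
Variables (p q : 'rV[R]_(n + l)) (M r : R).

Local Notation sq u := (dotv u u).

(** A triple [(z, w, x)] holds the copy for [f], the graph point and the copy for [C]. The vector
    [q] is a linear tilt, and the [M] term is the quadratic that makes [p] a strict minimizer. *)
Let F (t : 'rV[R]_n * 'rV[R]_(n + l) * 'rV[R]_n) : R :=
  f t.1.1 + dotv q (t.1.2 - p) + M * sq (t.1.2 - p).

Let P (t : 'rV[R]_n * 'rV[R]_(n + l) * 'rV[R]_n) : R :=
  sq (t.1.1 - lsubmx t.1.2) + sq (t.1.1 - t.2).

Let K : set ('rV[R]_n * 'rV[R]_(n + l) * 'rV[R]_n) :=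
  ([set z | `|lsubmx p - z| <= r] `*`
   ([set w | `|p - w| <= r] `&` graph_of Gamma)) `*`
  ([set x | `|lsubmx p - x| <= r] `&` C).

Let continuousF : continuous f -> continuous F.
Proof.
move=> cf t; have c1 : t'.1.1 @[t' --> t] --> t.1.1.
  by apply: (@cvg_comp _ _ _ fst fst _ (nbhs t.1)); exact: cvg_fst.
have c2 : t'.1.2 - p @[t' --> t] --> t.1.2 - p.
  apply: cvgB; last exact: cvg_cst.
  by apply: (@cvg_comp _ _ _ fst snd _ (nbhs t.1)); [exact: cvg_fst|exact: cvg_snd].
apply: cvgD; first apply: cvgD.
- exact: (cvg_comp _ _ c1 (cf _)).
- by apply: cvg_dotv => //; exact: cvg_cst.
- by apply: cvgM; [exact: cvg_cst|exact: cvg_dotv].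
Qed.

Let continuousP : continuous P.
Proof.
move=> t; have c1 : t'.1.1 @[t' --> t] --> t.1.1.
  by apply: (@cvg_comp _ _ _ fst fst _ (nbhs t.1)); exact: cvg_fst.
have c2 : t'.1.2 @[t' --> t] --> t.1.2.
  by apply: (@cvg_comp _ _ _ fst snd _ (nbhs t.1)); [exact: cvg_fst|exact: cvg_snd].
have c3 : lsubmx t'.1.2 @[t' --> t] --> lsubmx t.1.2.
  exact: (cvg_comp _ _ c2 (@continuous_lsubmx _ _ _ _ _)).
have c4 : t'.2 @[t' --> t] --> t.2 by exact: cvg_snd.
by apply: cvgD; apply: cvg_dotv; apply: cvgB.
Qed.

Let compactK : closed (graph_of Gamma) -> closed C -> compact K.
Proof.
move=> cG cC; apply: compact_setX; first apply: compact_setX.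
- exact: compact_norm_ball.
- by apply: compact_closedI => //; exact: compact_norm_ball.
- by apply: compact_closedI => //; exact: compact_norm_ball.
Qed.

Let minimizer (j : R) (t : 'rV[R]_n * 'rV[R]_(n + l) * 'rV[R]_n) :=
  K t /\ forall t', K t' -> F t + j * P t <= F t' + j * P t'.

(** Only the last block varies, so the normal is minus the gradient in [x] of [j |z - x|^2]. *)
Let minimizer_normal_C j z w x : minimizer j (z, w, x) ->
  `|lsubmx p - x| < r -> regular_normal_cone C x ((2 * j) *: (z - x)).
Proof.
move=> [Kt tmin] xr; have [[Kz [Kw Gw]] [Kx Cx]] := Kt.
rewrite -[_ *: _]opprK; apply: (@regular_normal_cone_min _ _ _ _ _ j) => //.
apply: filterS (near_norm_ball xr) => x' x'r Cx'.
have /tmin : K (z, w, x') by [].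
rewrite /F /P /= lerD2l dotvNl dotvZl (dotv_distC z x) (dotv_distC z x').
rewrite (dotv_dist_expand x x' z) -[z - x]opprB dotvNl; nra.
Qed.

(** Minus the gradient in [w] of tilt, quadratic and penalty. The penalty sees only the first block
    of the increment [d], so its remainder [j |lsubmx d|^2] is enlarged to [j |d|^2], which uses
    [0 <= j]. *)
Let minimizer_normal_graph j z w x : 0 <= j -> minimizer j (z, w, x) ->
  `|p - w| < r ->
  regular_normal_cone (graph_of Gamma) w
    (row_mx ((2 * j) *: (z - lsubmx w)) 0 - q - (2 * M) *: (w - p)).
Proof.
move=> j0 [Kt tmin] wr; have [[Kz [Kw Gw]] [Kx Cx]] := Kt.
rewrite -[X in regular_normal_cone _ _ X]opprK.
apply: (@regular_normal_cone_min _ _ _ _ _ (M + j)) => //.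
apply: filterS (near_norm_ball wr) => w' w'r Gw'.
have /tmin : K (z, w', x) by [].
rewrite /F /P /= (dotv_distC z (lsubmx w)) (dotv_distC z (lsubmx w')).
rewrite (dotv_dist_expand w w' p) (dotv_dist_expand (lsubmx w) (lsubmx w') z).
have -> : w' - p = (w - p) + (w' - w) by rewrite [RHS]addrC addrA subrK.
have -> : lsubmx w' - lsubmx w = lsubmx (w' - w) by rewrite linearB.
have := dotv_hsubmx (w' - w) (w' - w); move: (w' - w) => d hd.
rewrite -[z - lsubmx w]opprB.
have := mulr_ge0 j0 (dotv_ge0 (rsubmx d)).
move: (w - p) (lsubmx w - z) => v u.
rewrite !(dotvDl, dotvNl, dotvZl, dotvDr) (dotv_hsubmx (row_mx _ _)).
rewrite row_mxKl row_mxKr dotv0l addr0 dotvZl dotvNl hd; nra.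
Qed.

(** On the epigraph the height dominates [f], so putting it in place of [f] preserves the minimality
    inequality and makes that part of the objective linear; its derivative gives the component
    [-1]. *)
Let minimizer_normal_epigraph j z w x : 0 <= j -> minimizer j (z, w, x) ->
  `|lsubmx p - z| < r ->
  regular_normal_cone (epigraph f) (row_mx z (f z)%:M)
    (row_mx (- ((2 * j) *: (z - lsubmx w) + (2 * j) *: (z - x))) (- 1)%:M).
Proof.
move=> j0 [Kt tmin] zr; have [[Kz [Kw Gw]] [Kx Cx]] := Kt.
rewrite -[X in regular_normal_cone _ _ X]opprK.
apply: (@regular_normal_cone_min _ _ _ _ _ (2 * j)).
  by rewrite /epigraph /= row_mxKl row_mxKr mxE mulr1n.
have yr : \forall y \near row_mx z (f z)%:M, `|lsubmx p - lsubmx y| <= r.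
  have : lsubmx y @[y --> row_mx z (f z)%:M] --> lsubmx (row_mx z (f z)%:M).
    exact: continuous_lsubmx.
  by rewrite row_mxKl => /(_ _ (near_norm_ball zr)).
apply: filterS yr => y yr; rewrite /epigraph /= => fy.
have /tmin : K (lsubmx y, w, x) by [].
rewrite /F /P /= (dotv_dist_expand z (lsubmx y) (lsubmx w)).
rewrite (dotv_dist_expand z (lsubmx y) x).
rewrite opp_row_mx opprK 2!(dotv_hsubmx _ (y - _)) row_mxKl row_mxKr.
have -> : lsubmx (y - row_mx z (f z)%:M) = lsubmx y - z.
  by rewrite linearB /= row_mxKl.
have := mulr_ge0 j0 (dotv_ge0 (rsubmx (y - row_mx z (f z)%:M))).
have -> : dotv (- (- 1)%:M) (rsubmx (y - row_mx z (f z)%:M)) =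
    rsubmx y 0 0 - f z.
  by rewrite linearB /= row_mxKr /dotv big_ord1 !mxE !mulr1n opprK mul1r.
rewrite (dotvDl (_ *: _) (_ *: _)) !dotvZl; move: (dotv (rsubmx _) _) => c; nra.
Qed.

(** The tilt [q] stands for the gradient at [p] of a smooth part of the objective. Its second block
    becomes the coderivative argument because the coupling penalty does not act on the [y]
    variable. *)
Lemma multiplier_rule (U : set 'rV[R]_n) (V : set 'rV[R]_l) (kappa L : R) :
  continuous f -> closed (graph_of Gamma) -> closed C ->
  graph_of Gamma p -> C (lsubmx p) -> 0 < r ->
  (forall w, `|p - w| <= r -> graph_of Gamma w -> C (lsubmx w) -> w <> p ->
    f (lsubmx p) < f (lsubmx w) + dotv q (w - p) + M * sq (w - p)) ->
  nbhs (lsubmx p) U -> nbhs (rsubmx p) V -> 0 <= kappa -> 0 <= L ->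
  (forall x x', U x -> U x' -> Gamma x `&` V `<=` minkowski_sum (Gamma x')
     [set (kappa * enorm (x - x')) *: b | b in @eunit_ball R l]) ->
  (forall y z, U y -> U z -> `|f y - f z| <= L * enorm (y - z)) ->
  exists s u v, [/\ limiting_subdifferential f (lsubmx p) s, enorm s <= L,
    limiting_coderivative Gamma (lsubmx p) (rsubmx p) (rsubmx q) u,
    limiting_normal_cone C (lsubmx p) v & s + (u + v) + lsubmx q = 0].
Proof.
move=> cf cG cC Gp Cp r0 strict Up Vp k0 L0 aubin lip; set a := lsubmx p.
have P0 t : 0 <= P t by rewrite addr_ge0// dotv_ge0.
have Kp : K (a, p, a).
  by split; split => //=; rewrite ?subrr ?normr0 ?ltW.
have Pp : P (a, p, a) = 0 by rewrite /P /= !subrr !dotv0r addr0.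
have strictF t : K t -> P t = 0 -> t <> (a, p, a) -> F (a, p, a) < F t.
  (* A vanishing penalty forces [z = lsubmx w = x], so the triple is determined by [w]. *)
  move: t => [[z w] x] [[_ [/= wr Gw]] [_ /= Cx]] /eqP.
  rewrite paddr_eq0 ?dotv_ge0//= !dotv_eq0 !subr_eq0 => /andP[/eqP zw /eqP zx].
  rewrite -zx zw in Cx *; move=> wp; rewrite /F /= subrr !dotv0r mulr0 !addr0.
  by apply: strict => // wp'; apply: wp; rewrite wp'.
have [t_ [tmin tcvg]] := penalty_minimizers (compactK cG cC) (continuousF cf)
  continuousP P0 Kp Pp strictF.
pose z_ j := (t_ j).1.1; pose w_ j := (t_ j).1.2; pose x_ j := (t_ j).2.
have tE j : t_ j = (z_ j, w_ j, x_ j) by rewrite /z_ /w_ /x_; case: (t_ j) => [[]].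
have zcvg : z_ j @[j --> \oo] --> a.
  by apply: (cvg_comp _ (fun t => t.1.1) tcvg); 
    apply: (@cvg_comp _ _ _ fst fst _ (nbhs (a, p))); exact: cvg_fst.
have wcvg : w_ j @[j --> \oo] --> p.
  apply: (cvg_comp _ (fun t => t.1.2) tcvg).
  by apply: (@cvg_comp _ _ _ fst snd _ (nbhs (a, p)));
    [exact: cvg_fst|exact: cvg_snd].
have xcvg : x_ j @[j --> \oo] --> a.
  by apply: (cvg_comp _ snd tcvg); exact: cvg_snd.
pose U_ j := (2 * j%:R) *: (z_ j - lsubmx (w_ j)).
pose W_ j := (2 * j%:R) *: (z_ j - x_ j).
pose G_ j := row_mx (U_ j) 0 - q - (2 * M) *: (w_ j - p).
have tminj j : minimizer j%:R (z_ j, w_ j, x_ j).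
  by rewrite -tE; have [] := tmin j.
have Nf : \forall j \near \oo, regular_normal_cone (epigraph f)
    (row_mx (z_ j) (f (z_ j))%:M) (row_mx (- (U_ j + W_ j)) (- 1)%:M).
  apply: filterS (cvgr_dist_lt _ _ zcvg _ r0) => j zr.
  exact: minimizer_normal_epigraph.
have NG : \forall j \near \oo, regular_normal_cone (graph_of Gamma) (w_ j) (G_ j).
  apply: filterS (cvgr_dist_lt _ _ wcvg _ r0) => j wr.
  exact: minimizer_normal_graph.
have NC : \forall j \near \oo, regular_normal_cone C (x_ j) (W_ j).
  apply: filterS (cvgr_dist_lt _ _ xcvg _ r0) => j xr.
  exact: minimizer_normal_C.
have rGcvg : rsubmx (G_ j) @[j --> \oo] --> - rsubmx q.
  (* The possibly large vector [U_ j] enters the first block only; what remains besides [- rsubmx q]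
     tends to zero. *)
  have -> : (fun j => rsubmx (G_ j)) =
      (fun j => - rsubmx q - (2 * M) *: (rsubmx (w_ j) - rsubmx p)).
    apply/funext => j.
    by rewrite scalerBr /G_ !(linearB, linearZ) /= row_mxKr sub0r -scalerDr.
  rewrite -[X in _ --> X]subr0; apply: cvgB; first exact: cvg_cst.
  rewrite -(scaler0 _ (2 * M)) -(subrr (rsubmx p)).
  apply: cvgZ; first exact: cvg_cst.
  apply: cvgB; last exact: cvg_cst.
  exact: (cvg_comp _ _ wcvg (@continuous_rsubmx _ _ _ _ _)).
set B := kappa * (enorm (- rsubmx q) + 1).
have Sb : \forall j \near \oo, enorm (- (U_ j + W_ j)) <= L.
  (* The bound is applied at [z_ j], so [U] must be a neighborhood of that point; hence the passage
     through the interior of [U]. *)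
  near=> j; have Uz : nbhs (z_ j) U.
    by near: j; apply: (zcvg U°); exact: nbhs_interior.
  by apply: (regular_normal_epigraph_bound Uz L0 lip); near: j.
have rGb : \forall j \near \oo,
    enorm (rsubmx (G_ j)) <= enorm (- rsubmx q) + 1.
  have q1 : enorm (- rsubmx q) < enorm (- rsubmx q) + 1 by rewrite ltrDl.
  exact: (cvgr_le _ (cvg_enorm rGcvg) _ q1).
have Gb : \forall j \near \oo, enorm (lsubmx (G_ j)) <= B.
  near=> j; have Uw : nbhs (lsubmx (w_ j)) U.
    near: j; have : lsubmx (w_ j) @[j --> \oo] --> lsubmx p.
      exact: (cvg_comp _ _ wcvg (@continuous_lsubmx _ _ _ _ _)).
    by move=> /(_ U°); apply; exact: nbhs_interior.
  have Vw : V (rsubmx (w_ j)).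
    near: j; have : rsubmx (w_ j) @[j --> \oo] --> rsubmx p.
      exact: (cvg_comp _ _ wcvg (@continuous_rsubmx _ _ _ _ _)).
    by apply.
  have NGj : regular_normal_cone (graph_of Gamma) (w_ j) (G_ j) by near: j.
  apply: le_trans (aubin_regular_normal_bound Uw Vw k0 aubin NGj) _.
  by rewrite ler_wpM2l//; near: j.
have [|[s u] [phi [_ phicvg sucvg]]] := @compact_subsequence R _ _
    (fun j => (- (U_ j + W_ j), lsubmx (G_ j)))
    (compact_setX (@compact_norm_ball R n 0 L) (@compact_norm_ball R n 0 B)).
  by apply: filterS2 Sb Gb => j Sj Gj; split => /=;
    rewrite sub0r normrN (le_trans (normr_le_enorm _)).
have scvg : - (U_ (phi k) + W_ (phi k)) @[k --> \oo] --> s.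
  by apply: (cvg_comp _ fst sucvg); exact: cvg_fst.
have ucvg : lsubmx (G_ (phi k)) @[k --> \oo] --> u.
  by apply: (cvg_comp _ snd sucvg); exact: cvg_snd.
have zphi := cvg_comp _ _ phicvg zcvg.
have wphi := cvg_comp _ _ phicvg wcvg.
have xphi := cvg_comp _ _ phicvg xcvg.
(* The normals [W_ j] need no compactness argument of their own: they are combinations of the two
   convergent sequences, [q] and a vanishing term. *)
exists s, u, (- s - u - lsubmx q); split.
- apply: (limiting_subdifferential_closed cf zphi scvg).
  near=> k; apply: regular_limiting_normal_cone; near: k; exact: (phicvg _ Nf).
- apply: (ler_cvg_to (cvg_enorm scvg) (cvg_cst L)).
  exact: (phicvg _ Sb).
- rewrite /limiting_coderivative /= hsubmxK.
  apply: (limiting_normal_cone_closed Gp wphi (v_ := G_ \o phi)).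
  + under eq_fun do rewrite /= -[G_ _]hsubmxK.
    exact: (cvg_row_mx ucvg (cvg_comp _ _ phicvg rGcvg)).
  + near=> k; apply: regular_limiting_normal_cone; near: k.
    exact: (phicvg _ NG).
- apply: (limiting_normal_cone_closed Cp xphi (v_ := W_ \o phi)).
  + have -> : W_ \o phi = (fun k => - (- (U_ (phi k) + W_ (phi k))) -
        lsubmx (G_ (phi k)) - lsubmx q -
        (2 * M) *: (lsubmx (w_ (phi k)) - lsubmx p)).
      apply/funext => k /=.
      have -> : lsubmx (G_ (phi k)) =
          U_ (phi k) - lsubmx q - lsubmx ((2 * M) *: (w_ (phi k) - p)).
        by rewrite [LHS]linearB [X in X - _]linearB /= row_mxKl.
      by apply/rowP => i; rewrite !mxE; ring.
    rewrite -[X in _ --> X]subr0 -(scaler0 _ (2 * M)) -(subrr (lsubmx p)).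
    have lwphi : lsubmx (w_ (phi k)) @[k --> \oo] --> lsubmx p.
      exact: (cvg_comp _ _ wphi (@continuous_lsubmx _ _ _ _ _)).
    exact: (cvgB (cvgB (cvgB (cvgN scvg) ucvg) (cvg_cst _))
      (cvgZ (cvg_cst _) (cvgB lwphi (cvg_cst _)))).
  + near=> k; apply: regular_limiting_normal_cone; near: k.
    exact: (phicvg _ NC).
- by apply/rowP => i; rewrite !mxE; ring.
Unshelve. all: by end_near. Qed.

End MultiplierRule.

(** * Penalizing the constraint [0 \in Gamma x] and passing to the limit by dAM-regularity *)

Theorem theorem4p6 (R : realType) (n l : nat)
    (f : 'rV[R]_n -> R) (Gamma : 'rV[R]_n -> set 'rV[R]_l)
    (C : set 'rV[R]_n) (x0 : 'rV[R]_n)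
    (hf : locally_lipschitz f)
    (hGamma : closed (graph_of Gamma))
    (hC0 : C !=set0) (hC : closed C)
    (hmin : local_minimizer f (feasible Gamma C) x0)
    (hreg : dAM_regular Gamma C x0)
    (hAubin : aubin_property Gamma x0 0) :
  M_stationary f Gamma C x0.
Proof.
have cf := locally_lipschitz_continuous hf.
have [[G0 C0] fmin] := hmin; have [_ reg] := hreg.
have [Gp [U' [V [kappa [U'x Vy k0 aubin']]]]] := hAubin.
have [U'' U''x [L' lip']] := hf x0.
(* The given Lipschitz constant may be negative in degenerate cases; its absolute value is still
   valid. *)
pose U := U' `&` U''; pose L := `|L'|.
have Ux : nbhs x0 U by exact: filterI.
have aubin x x' : U x -> U x' -> Gamma x `&` V `<=` minkowski_sum (Gamma x')
    [set (kappa * enorm (x - x')) *: b | b in @eunit_ball R l].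
  by move=> [? _] [? _]; exact: aubin'.
have lip y z : U y -> U z -> `|f y - f z| <= L * enorm (y - z).
  move=> [_ Uy] [_ Uz]; apply: le_trans (lip' _ _ Uy Uz) _.
  by rewrite ler_wpM2r ?enorm_ge0// ler_norm.
set p := row_mx x0 (0 : 'rV[R]_l).
have lcvg : lsubmx w @[w --> p] --> x0.
  by rewrite -[X in _ --> X](row_mxKl x0 (0 : 'rV[R]_l)); exact: continuous_lsubmx.
have rcvg : rsubmx w @[w --> p] --> (0 : 'rV[R]_l).
  by rewrite -[X in _ --> X](row_mxKr x0 (0 : 'rV[R]_l)); exact: continuous_rsubmx.
have [r r0 hr] := nbhs_norm_le (lcvg _ fmin).
pose K := [set w : 'rV[R]_(n + l) | `|p - w| <= r] `&`
  (graph_of Gamma `&` [set w | C (lsubmx w)]).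
(* The squared distance turns the local minimizer [x0] into a strict one, as convergence of the
   penalty minimizers requires. *)
pose F (w : 'rV[R]_(n + l)) :=
  f (lsubmx w) + dotv (lsubmx w - x0) (lsubmx w - x0).
pose P (w : 'rV[R]_(n + l)) := dotv (rsubmx w) (rsubmx w).
have cK : compact K.
  apply: compact_closedI; first exact: compact_norm_ball.
  apply: closedI => //; apply: (@preimage_closed _ _ lsubmx C) => //.
  by move=> w _; exact: continuous_lsubmx.
have cF : continuous F.
  move=> w; have lw : lsubmx w' @[w' --> w] --> lsubmx w.
    exact: continuous_lsubmx.
  have lw0 : lsubmx w' - x0 @[w' --> w] --> lsubmx w - x0.
    exact: (cvgB lw (cvg_cst x0)).
  have fw : f (lsubmx w') @[w' --> w] --> f (lsubmx w).
    exact: (cvg_comp _ f lw (cf (lsubmx w))).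
  by apply: (@cvgD _ _ _ (nbhs w)) => //; exact: (@cvg_dotv _ _ _ (nbhs w)).
have cP : continuous P.
  by move=> w; apply: (@cvg_dotv _ _ _ (nbhs w)); exact: continuous_rsubmx.
have P0 w : 0 <= P w by exact: dotv_ge0.
have Kp : K p.
  by split; rewrite /= ?subrr ?normr0 ?ltW//; split; rewrite //= row_mxKl.
have Pp : P p = 0 by rewrite /P row_mxKr dotv0r.
have uniq w : K w -> P w = 0 -> w <> p -> F p < F w.
  move=> [wr [Gw Cw]] /eqP; rewrite dotv_eq0 => /eqP rw wp.
  rewrite /F row_mxKl subrr dotv0r; apply: ler_ltD.
    by apply: hr => //; split => //; rewrite -rw.
  rewrite lt_def dotv_ge0 andbT dotv_eq0 subr_eq0; apply: contra_notN wp => /eqP lw.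
  by rewrite -[w]hsubmxK lw rw.
have [w_ [wmin wcvg]] := penalty_minimizers cK cF cP P0 Kp Pp uniq.
have lwcvg : lsubmx (w_ k) @[k --> \oo] --> x0 by exact: (cvg_comp _ _ wcvg lcvg).
have rwcvg : rsubmx (w_ k) @[k --> \oo] --> (0 : 'rV[R]_l).
  exact: (cvg_comp _ _ wcvg rcvg).
(* The bound [L] comes from a fixed neighborhood of [x0] and is the same for all [k]. *)
have : \forall k \near \oo, exists s, [/\ enorm s <= L,
    limiting_subdifferential f (lsubmx (w_ k)) s &
    Mtilde Gamma C (lsubmx (w_ k)) (rsubmx (w_ k))
      (- s - 2 *: (lsubmx (w_ k) - x0))].
  near=> k.
  have wr : `|p - w_ k| < r by near: k; exact: (cvgr_dist_lt _ _ wcvg _ r0).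
  have Uk : nbhs (lsubmx (w_ k)) U.
    by near: k; apply: (lwcvg U°); exact: nbhs_interior.
  have Vk : nbhs (rsubmx (w_ k)) V.
    by near: k; apply: (rwcvg V°); exact: nbhs_interior.
  have [e e0 he] := nbhs_norm_le (near_norm_ball wr).
  have [[_ [Gk Ck]] mink] := wmin k.
  (* This is the gradient at [w_ k] of the squared distance to [x0] plus [k |y|^2]. *)
  pose q := row_mx (2 *: (lsubmx (w_ k) - x0)) ((2 * k%:R) *: rsubmx (w_ k)).
  (* The exact quadratic remainder is [|dx|^2 + k |dy|^2], so the coefficient [k + 2] leaves a
     surplus of at least [|w - w_ k|^2], even at [k = 0]. *)
  have strict w : `|w_ k - w| <= e -> graph_of Gamma w -> C (lsubmx w) ->
      w <> w_ k -> f (lsubmx (w_ k)) < f (lsubmx w) + dotv q (w - w_ k) +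
        (k%:R + 2) * dotv (w - w_ k) (w - w_ k).
    move=> /he wp Gw Cw wwk; have /mink : K w by [].
    rewrite /F /P (dotv_dist_expand (lsubmx (w_ k)) (lsubmx w) x0).
    have := dotv_dist_expand (rsubmx (w_ k)) (rsubmx w) 0; rewrite !subr0 => ->.
    have : 0 < dotv (w - w_ k) (w - w_ k).
      by rewrite lt_def dotv_ge0 andbT dotv_eq0 subr_eq0; apply/eqP.
    rewrite !(dotv_hsubmx _ (w - w_ k)) row_mxKl row_mxKr !dotvZl !linearB /=.
    have := dotv_ge0 (lsubmx w - lsubmx (w_ k)).
    have := dotv_ge0 (rsubmx w - rsubmx (w_ k)).
    have := ler0n R k; nra.
  have [s [u [v [sf sL uG vC suv]]]] :=
    multiplier_rule cf hGamma hC Gk Ck e0 strict Uk Vk (ltW k0) (normr_ge0 L')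
      aubin lip.
  exists s; split => //; exists u; first by exists (rsubmx q).
  exists v => //; move/eqP: suv; rewrite row_mxKl addr_eq0 => /eqP suv.
  by rewrite -suv addKr.
(* Shifting the index by [N] turns the eventual statement into one for every [k], so that [choice]
   applies. *)
move=> [N _ /(_ _ (leq_addl _ _))/= hN].
have [s_ hs] := choice hN.
have [|s [phi [_ phicvg scvg]]] :=
    @compact_subsequence R _ _ s_ (@compact_norm_ball R n 0 L).
  apply: nearW => k; have [sL _ _] := hs k.
  by rewrite /= sub0r normrN (le_trans (normr_le_enorm _)).
have psicvg : (phi k + N)%N @[k --> \oo] --> \oo.
  exact: (cvg_comp _ _ phicvg (cvg_addnr N)).
have lphi := cvg_comp _ _ psicvg lwcvg.
have sf : limiting_subdifferential f x0 s.
  apply: (limiting_subdifferential_closed cf lphi scvg).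
  by apply: nearW => k; have [_] := hs (phi k).
have /reg : outer_limit (Mtilde Gamma C) x0 0 (- s).
  exists (fun k => lsubmx (w_ (phi k + N))), (fun k => rsubmx (w_ (phi k + N))),
    (fun k => - s_ (phi k) - 2 *: (lsubmx (w_ (phi k + N)) - x0)); split => //.
  - exact: (cvg_comp _ _ psicvg rwcvg).
  - rewrite -[- s]subr0 -(scaler0 _ 2) -(subrr x0).
    apply: cvgB; first exact: cvgN.
    by apply: cvgZ; [exact: cvg_cst|apply: cvgB => //; exact: cvg_cst].
  - by move=> k; have [_ _] := hs (phi k).
(* The multiplier is provided by regularity at the limit point, not as a limit of the vectors
   [2 k y_k], for which no bound is established. *)
move=> [u [lambda _ uG] [v vC uv]].
exists lambda, (s + u); first by exists s => //; exists u.
by exists v => //; rewrite -addrA uv subrr.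
Unshelve. all: by end_near. Qed.
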